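(* Let $n\ge 1$ be an integer, let $q$ be a prime power, let $\mathcal{C}\subseteq \mathrm{U}(n,\mathbb{F}_q)$ be a linear flag-rank-metric code with minimum distance $\delta=5$, and let $\alpha$ be its codimension. Then $\mathcal{C}$ is perfect if and only if \[ n=\frac{-(2q^2-q+3)+\sqrt{(2q^2+q+1)^2+8(q^\alpha-q)}}{2(q-1)}. \] Moreover, necessarily $\alpha>\delta$ (that is, $\alpha>5$).
   Context: $\mathbb{F}_q$ is the finite field with $q$ elements. $\mathrm{U}(n,\mathbb{F}_q)$ is the $\mathbb{F}_q$-vector space of $n\times n$ upper triangular matrices over $\mathbb{F}_q$; it has dimension $\frac{n(n+1)}{2}$. For $M\in \mathrm{U}(n,\mathbb{F}_q)$ and $1\le i\le n$, $M_{[i]}$ is the $i\times(n-i+1)$ submatrix of $M$ obtained by deleting the first $i-1$ columns and the last $n-i$ rows (i.e. rows $1,\dots,i$ and columns $i,\dots,n$). The flag-rank weight of $M$ is $\mathrm{fr}(M)=\sum_{i=1}^{n}\mathrm{rk}(M_{[i]})$; the flag-rank distance is $\mathrm{d}_{\mathrm{fr}}(A,B)=\mathrm{fr}(A-B)$. A linear flag-rank-metric code is an $\mathbb{F}_q$-subspace $\mathcal{C}$ of $\mathrm{U}(n,\mathbb{F}_q)$; its minimum (flag-rank) distance, defined when $\mathcal{C}\neq\{\boldsymbol{0}\}$, is $\delta=\min\{\mathrm{fr}(M):M\in\mathcal{C}\setminus\{\boldsymbol{0}\}\}$. Its codimension is $\frac{n(n+1)}{2}-\dim_{\mathbb{F}_q}(\mathcal{C})$.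 Let $b_q(n,t)=|\{A\in \mathrm{U}(n,\mathbb{F}_q):\mathrm{fr}(A)\le t\}|$. A code $\mathcal{C}$ with minimum distance $\delta$ is perfect if $|\mathcal{C}|\,b_q(n,t)=q^{\frac{n(n+1)}{2}}$, where $t=\left\lfloor\frac{\delta-1}{2}\right\rfloor$. *)

(* Defs.v *)
From mathcomp Require Import all_boot all_order all_algebra.

Set Implicit Arguments.
Unset Strict Implicit.
Unset Printing Implicit Defensive.

Local Open Scope ring_scope.

(* [is_trig_mx] is lower triangularity, whence the transpose. *)
Definition upper_mx (F : fieldType) (n : nat) (M : 'M[F]_n) : bool :=
  is_trig_mx M^T.

Lemma flag_col_subproof (n : nat) (i : 'I_n) (c : 'I_(n - i)) : (i + c < n)%N.
Proof. by rewrite -ltn_subRL. Qed.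

Definition flag_col (n : nat) (i : 'I_n) (c : 'I_(n - i)) : 'I_n :=
  Ordinal (flag_col_subproof c).

(* Indices are 0-based: for i : 'I_n this is M_[i+1], made of the first i + 1
   rows and the last n - i columns of M. *)
Definition flag_sub (F : fieldType) (n : nat) (M : 'M[F]_n) (i : 'I_n) :
    'M[F]_(i.+1, n - i) :=
  mxsub (widen_ord (ltn_ord i)) (@flag_col n i) M.

Definition flag_rank (F : fieldType) (n : nat) (M : 'M[F]_n) : nat :=
  (\sum_(i < n) \rank (flag_sub M i))%N.

Definition linear_fr_code (F : fieldType) (n : nat) (C : {vspace 'M[F]_n}) :
    Prop :=
  forall M, M \in C -> upper_mx M.

(* No integer d satisfies this when C is the zero code. *)
Definition has_min_distance (F : fieldType) (n : nat) (C : {vspace 'M[F]_n})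
    (d : nat) : Prop :=
  (exists M, [/\ M \in C, M != 0 & flag_rank M = d]) /\
  (forall M, M \in C -> M != 0 -> (d <= flag_rank M)%N).

Definition codimension (F : fieldType) (n : nat) (C : {vspace 'M[F]_n}) : nat :=
  ((n * n.+1) %/ 2 - \dim C)%N.

Definition fr_ball (F : finFieldType) (n t : nat) : nat :=
  #|[set A : 'M[F]_n | upper_mx A & (flag_rank A <= t)%N]|.

Definition perfect_code (F : finFieldType) (n : nat) (C : {vspace 'M[F]_n}) :
    Prop :=
  exists2 d, has_min_distance C d &
    (#|[set M : 'M[F]_n | M \in C]| * fr_ball F n ((d - 1) %/ 2)
     = #|F| ^ ((n * n.+1) %/ 2))%N.

(* Main.v *)
(**
  If M is upper triangular with fr(M) <= 2, at most two of the blocks M_[i] are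
  nonzero.  A nonzero entry (c, d) makes M_[c], ..., M_[d] nonzero, so M is
  either diagonal with at most two nonzero entries, or supported on
  (i, i), (i, i+1), (i+1, i+1) with a nonzero (i, i+1) entry.  Hence
    b_q(n, 2) = 1 + n (q-1) + C(n, 2) (q-1)^2 + (n-1) q^2 (q-1),
  and C is perfect iff b_q(n, 2) = q^alpha; this is a quadratic equation in n
  with a single admissible root.

  For alpha > 5, the matrices supported on the upper left 3 x 3 corner form a
  6-dimensional space of matrices with fr <= 1 + 2 + 1 = 4, which therefore
  meets C trivially.
*)
Require Import Defs.
From mathcomp Require Import all_boot all_order all_algebra finfield.
From mathcomp Require Import zify ring lra.

Set Implicit Arguments.
Unset Strict Implicit.
Unset Printing Implicit Defensive.

Import Order.TTheory GRing.Theory Num.Theory.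

Local Open Scope ring_scope.

(** * Flag blocks: vanishing, rank bounds and support *)

Lemma upper_mxP (F : fieldType) n (M : 'M[F]_n) :
  reflect (forall i j : 'I_n, (j < i)%N -> M i j = 0) (upper_mx M).
Proof.
apply: (iffP is_trig_mxP) => h i j lt; first by move: (h j i lt); rewrite mxE.
by rewrite mxE h.
Qed.

Section FlagRank.

Variables (F : fieldType) (n : nat).
Implicit Types (M : 'M[F]_n) (i : 'I_n).

Lemma flag_sub_eq0 M i :
  flag_sub M i = 0 <-> (forall c d : 'I_n, (c <= i <= d)%N -> M c d = 0).
Proof.
split=> [M0 c d /andP[le_ci le_id] | M0].
  have lt_c : (c < i.+1)%N by [].
  have lt_d : (d - i < n - i)%N by have := ltn_ord d; lia.
  move/matrixP: M0 => /(_ (Ordinal lt_c) (Ordinal lt_d)).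
  rewrite !mxE => <-; congr (M _ _); apply: val_inj => //=.
  by rewrite subnKC.
by apply/matrixP=> a b; rewrite !mxE M0 //= leq_addr andbT -ltnS.
Qed.

(** A block with one nonzero row is an outer product, indicator column times that row. If [r > i],
    the indicator vanishes and so does the block. *)
Lemma rank_flag_sub_row M i (r : 'I_n) :
    (forall c d : 'I_n, (c <= i <= d)%N -> c != r -> M c d = 0) ->
  (\rank (flag_sub M i) <= 1)%N.
Proof.
move=> Mr; pose u : 'cV[F]_i.+1 := \col_a ((a : nat) == r)%:R.
pose v : 'rV[F]_(n - i) := \row_b M r (flag_col b).
rewrite (_ : flag_sub M i = u *m v) ?mulmx_max_rank //.
apply/matrixP=> a b; rewrite !mxE big_ord1 !mxE.
have [ar | ne_ar] := eqVneq (a : nat) r.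
  by rewrite mul1r; congr (M _ _); apply: val_inj.
by rewrite mul0r Mr //= -ltnS ltn_ord leq_addr.
Qed.

Lemma rank_flag_sub_col M i (r : 'I_n) :
    (forall c d : 'I_n, (c <= i <= d)%N -> d != r -> M c d = 0) ->
  (\rank (flag_sub M i) <= 1)%N.
Proof.
move=> Mr; pose v : 'rV[F]_(n - i) := \row_b ((i + b)%N == r)%:R.
pose u : 'cV[F]_i.+1 := \col_a M (widen_ord (ltn_ord i) a) r.
rewrite (_ : flag_sub M i = u *m v) ?mulmx_max_rank //.
apply/matrixP=> a b; rewrite !mxE big_ord1 !mxE.
have [br | ne_br] := eqVneq (i + b)%N r.
  by rewrite mulr1; congr (M _ _); apply: val_inj.
by rewrite mulr0 Mr //= -ltnS ltn_ord leq_addr.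
Qed.

(** Its size bounds the flag rank from below, and from above too when all blocks have rank at most
    1. This reduces flag rank at most 2 to a question about positions of nonzero entries. *)
Definition flag_support M : {set 'I_n} := [set i | flag_sub M i != 0].

Lemma flag_supportP M i :
  reflect (exists c d : 'I_n, (c <= i <= d)%N /\ M c d != 0)
          (i \in flag_support M).
Proof.
rewrite inE; apply: (iffP idP) => [nz | [c] [d] [cid Mcd]]; last first.
  by apply: contraNneq Mcd => /flag_sub_eq0/(_ c d cid)->.
have [/existsP[c /existsP[d /andP[? ?]]]|] :=
    boolP [exists c : 'I_n, exists d : 'I_n, (c <= i <= d)%N && (M c d != 0)].
  by exists c, d.
move=> /existsPn no; case/eqP: nz; apply/flag_sub_eq0 => c d cid.
by move: (no c) => /existsPn/(_ d); rewrite cid /= negbK => /eqP.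
Qed.

Lemma card_flag_support_le M : (#|flag_support M| <= flag_rank M)%N.
Proof.
rewrite -sum1_card /flag_rank big_mkcond; apply: leq_sum => i _.
by rewrite inE -mxrank_eq0; case: (\rank _).
Qed.

Lemma flag_rank_le_card M (Z : {set 'I_n}) :
    (forall i, (\rank (flag_sub M i) <= 1)%N) ->
    flag_support M \subset Z -> (flag_rank M <= #|Z|)%N.
Proof.
move=> r1 /subsetP sMZ; rewrite -sum1_card /flag_rank [leqRHS]big_mkcond.
apply: leq_sum => i _; case: ifPn => [_ // | /(contraNN (sMZ i))].
by rewrite inE negbK => /eqP->; rewrite mxrank0.
Qed.

Lemma flag_rank_corner M :
  (forall c d : 'I_n, (3 <= d)%N -> M c d = 0) -> upper_mx M ->
  (flag_rank M <= 4)%N.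
Proof.
move=> M0 /upper_mxP Mup.
(* The first two bounds are row counts; at [i = 2] only column 2 survives; the default value 0 of
   [nth] covers the vanishing blocks [i >= 3]. *)
have rk i : (\rank (flag_sub M i) <= nth 0%N [:: 1; 2; 1]%N i)%N.
  case: (ltnP i 3) => [lt_i3 | le_3i].
    have [i2 | ne_i2] := eqVneq (i : nat) 2.
      rewrite [X in nth _ _ X]i2.
      apply: (@rank_flag_sub_col M i i) => c d /andP[_ le_id] ne_di.
      by apply: M0; rewrite -val_eqE /= in ne_di; lia.
    apply: leq_trans (rank_leq_row _) _.
    by move: ne_i2 lt_i3; case: (nat_of_ord i) => [|[|[|]]].
  rewrite nth_default // leqn0 mxrank_eq0; apply/eqP/flag_sub_eq0 => c d cid.
  by apply: M0; lia.
apply: leq_trans (leq_sum _ (fun i _ => rk i)) _.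
rewrite {M M0 Mup rk}; case: n => [|[|[|m]]]; rewrite ?big_ord0 //.
- by rewrite big_ord1.
- by rewrite !big_ord_recl big_ord0.
by rewrite !big_ord_recl /= big1 // => i _; rewrite nth_nil.
Qed.

End FlagRank.

(** * Codimension at least 6 *)

Lemma card_noncorner n : (3 <= n)%N ->
  #|[set p : 'I_n * 'I_n | (p.1 <= p.2)%N && (3 <= p.2)%N]|
  = ((n * n.+1) %/ 2 - 6)%N.
Proof.
(* Count by columns: the rows meeting column [j] on or above the diagonal are [0, ..., j]. *)
move=> n3; have -> : #|[set p : 'I_n * 'I_n | (p.1 <= p.2)%N && (3 <= p.2)%N]|
    = (\sum_(j < n) (if 3 <= j then j.+1 else 0))%N.
  rewrite -sum1_card.
  rewrite (eq_bigl (fun p : 'I_n * 'I_n => (p.1 <= p.2)%N && (3 <= p.2)%N));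
    last by move=> p; rewrite inE.
  rewrite -(@pair_big_dep _ _ _ _ _ predT
     (fun i j : 'I_n => (i <= j)%N && (3 <= j)%N) (fun _ _ => 1%N)) /=.
  under eq_bigr do rewrite big_mkcond.
  rewrite exchange_big; apply: eq_bigr => j _; rewrite -big_mkcond sum1_card.
  have [le3j | gt3j] := leqP 3 j; last first.
    by apply: eq_card0 => i; rewrite unfold_in /= andbF.
  have le_jn : (j.+1 <= n)%N by [].
  have widen_inj : injective (widen_ord le_jn).
    by move=> a b /(congr1 val) /= /val_inj.
  rewrite -[RHS]card_ord -(card_imset _ widen_inj).
  apply: eq_card => i; rewrite [LHS]unfold_in /= andbT.
  apply/idP/imsetP => [le_ij | [k _ ->]].
    by exists (Ordinal (le_ij : i < j.+1)%N) => //; apply: val_inj.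
  by rewrite /= -ltnS.
rewrite -(big_mkord xpredT (fun j => if (3 <= j)%N then j.+1 else 0%N)).
elim: n n3 => // n IHn; rewrite ltnS leq_eqVlt => /predU1P[<- | lt3n].
  by rewrite !big_nat_recr // big_geq.
have ge6 : (6 <= (n * n.+1) %/ 2)%N by rewrite leq_divRL //; nia.
rewrite big_nat_recr //= IHn //.
have -> : (n.+1 * n.+2 = n.+1 * 2 + n * n.+1)%N by ring.
by rewrite divnMDl // lt3n; lia.
Qed.

Lemma card_code (F : finFieldType) n (C : {vspace 'M[F]_n}) :
  #|[set M : 'M[F]_n | M \in C]| = (#|F| ^ \dim C)%N.
Proof.
rewrite -(@card_vspace F 'M[F]_n (Vector.class 'M[F]_n) C).
by apply: eq_card => M; rewrite inE.
Qed.

(** Reading off the upper triangular entries outside the 3 x 3 corner is injective on [C]: a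
    difference of codewords in the kernel has flag rank at most 4, hence is zero. Comparing
    cardinalities bounds the dimension. *)
Lemma dim_code_le (F : finFieldType) n (C : {vspace 'M[F]_n}) :
  linear_fr_code C -> has_min_distance C 5 ->
  (\dim C + 6 <= (n * n.+1) %/ 2)%N.
Proof.
move=> codeC [[M [CM nzM frM]] minC].
have C0 A : A \in C -> (forall c d : 'I_n, (3 <= d)%N -> A c d = 0) -> A = 0.
  move=> CA A0; apply/eqP; apply: contraTT (flag_rank_corner A0 (codeC A CA)).
  by move=> nzA; rewrite -ltnNge minC.
(* For [n < 3] every matrix lies in the corner, so the nonzero codeword [M] could not exist. *)
have n_ge3 : (3 <= n)%N.
  rewrite leqNgt; apply: contra nzM => lt_n3; apply/eqP/C0 => // c d le3d.
  by have := ltn_ord d; lia.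
pose S := [set p : 'I_n * 'I_n | (p.1 <= p.2)%N && (3 <= p.2)%N].
pose f (A : 'M[F]_n) : {ffun {p | p \in S} -> F} :=
  [ffun p => A (val p).1 (val p).2].
have f_inj : {in [set M | M \in C] &, injective f}.
  move=> A B; rewrite !inE => CA CB fAB; apply/subr0_eq/C0; first exact: memvB.
  move=> c d le3d; rewrite !mxE; have [le_cd | lt_dc] := leqP c d; last first.
    have /upper_mxP -> // := codeC A CA; have /upper_mxP -> // := codeC B CB.
    by rewrite subr0.
  have Scd : (c, d) \in S by rewrite inE le_cd.
  move/ffunP: fAB => /(_ (exist (fun p => p \in S) (c, d) Scd)).
  by rewrite !ffunE /= => ->; rewrite subrr.
have := leq_card_in _ _ f_inj; rewrite card_ffun card_sig card_code.
rewrite leq_exp2l ?finNzRing_gt1 // (eq_card (B := S)) // card_noncorner //.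
move=> le_dim.
have ge6 : (6 <= (n * n.+1) %/ 2)%N by rewrite leq_divRL //; nia.
by move: ge6 le_dim; lia.
Qed.

(** * Size of the ball of radius 2 *)

Section Ball.

Variables (F : finFieldType).

Definition diag_of n (d : {ffun 'I_n -> F}) : 'M[F]_n :=
  \matrix_(i, j) (if i == j then d i else 0).

Definition sparse n :=
  [set d : {ffun 'I_n -> F} | (#|[set i | d i != 0%R]| <= 2)%N].

(** Parameters of the non-diagonal matrices in the ball: a place on the diagonal, two diagonal
    entries, and the superdiagonal entry, which must be nonzero. *)
Definition sq_dom m := [set p : 'I_m * (F * F * F) | p.2.2 != 0].

Lemma diag_of_inj n : injective (@diag_of n).
Proof.
move=> d e /matrixP de; apply/ffunP=> i.
by have := de i i; rewrite !mxE eqxx.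
Qed.

(** Sort by support: each point of a fixed support [B] takes any nonzero value independently, and
    the sizes 0, 1, 2 give the three terms. *)
Lemma card_sparse n :
  #|sparse n| = (1 + n * #|F|.-1 + 'C(n, 2) * #|F|.-1 ^ 2)%N.
Proof.
have card_supp (B : {set 'I_n}) :
    #|[set d : {ffun 'I_n -> F} | [set i | d i != 0] == B]|
    = (#|F|.-1 ^ #|B|)%N.
  have <- : #|[pred x : F | x != 0]| = #|F|.-1.
    by have := cardC1 (0 : F) => <-; apply: eq_card => x; rewrite !inE.
  rewrite -(card_pffun_on 0); apply: eq_card => d; rewrite inE.
  apply/eqP/pffun_onP => [<- | [/subsetP sdB dB]].
    split; first by apply/subsetP => i; rewrite !inE.
    by move=> _ /imageP[i iB ->]; rewrite !inE in iB *.
  apply/setP=> i; rewrite inE; apply/idP/idP => [di | iB]; first exact: sdB.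
  by have := dB (d i) (image_f _ iB); rewrite inE.
have card_k k : #|[set d : {ffun 'I_n -> F} | #|[set i | d i != 0]| == k]|
    = ('C(n, k) * #|F|.-1 ^ k)%N.
  rewrite -[in 'C(_, _)](card_ord n) -card_draws -sum1_card.
  rewrite (partition_big (fun d : {ffun 'I_n -> F} => [set i | d i != 0])
             (fun B : {set 'I_n} => #|B| == k)) /=; last by move=> d; rewrite inE.
  rewrite -sum_nat_const; apply: eq_big => [B | B /eqP <-]; first by rewrite inE.
  rewrite sum1dep_card -card_supp; apply: eq_card => d; rewrite !inE andb_idl //.
  by move/eqP->.
have -> : sparse n = [set d : {ffun 'I_n -> F} | #|[set i | d i != 0]| == 0%N]
    :|: [set d : {ffun 'I_n -> F} | #|[set i | d i != 0]| == 1%N]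
    :|: [set d : {ffun 'I_n -> F} | #|[set i | d i != 0]| == 2%N].
  by apply/setP=> d; rewrite !inE; case: #|_| => [|[|[|]]].
have disj (j k : nat) : j != k ->
    [set d : {ffun 'I_n -> F} | #|[set i | d i != 0]| == j]
      :&: [set d : {ffun 'I_n -> F} | #|[set i | d i != 0]| == k] = set0.
  move=> njk; apply/setP=> d; rewrite !inE; apply/negP=> /andP[/eqP->].
  exact/negP.
rewrite !cardsU setIUl !disj // setU0 cards0 !subn0 !card_k.
by rewrite bin0 bin1 mul1n expn0 expn1.
Qed.

Lemma card_sq_dom m : #|sq_dom m| = (m * (#|F| * #|F| * #|F|.-1))%N.
Proof.
have -> : sq_dom m = setX [set: 'I_m] (setX [set: F * F] [set~ 0]).
  by apply/setP=> -[i [[x y] z]]; rewrite !inE.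
by rewrite !cardsX !cardsT cardsC1 card_prod card_ord.
Qed.


Section Square.

Variable m : nat.

(** With matrix size [m.+1], the superdiagonal is indexed by ['I_m]: its entry number [i] sits at
    [(lo i, hi i)]. *)
Definition lo (i : 'I_m) : 'I_m.+1 := widen_ord (leqnSn m) i.
Definition hi (i : 'I_m) : 'I_m.+1 := lift ord0 i.

Lemma lo_inj : injective lo.
Proof. by move=> i j /(congr1 val) /= /val_inj. Qed.

Lemma loE i : lo i = i :> nat.
Proof. by []. Qed.

Lemma hiE i : hi i = i.+1 :> nat.
Proof. exact: lift0. Qed.

Lemma lo_eq_hi i : (lo i == hi i) = false.
Proof. by rewrite -val_eqE /= ltn_eqF. Qed.

Lemma hi_eq_lo i : (hi i == lo i) = false.
Proof. by rewrite eq_sym lo_eq_hi. Qed.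

Definition sq_mx (p : 'I_m * (F * F * F)) : 'M[F]_m.+1 :=
  \matrix_(a, b)
    if (a == lo p.1) && (b == lo p.1) then p.2.1.1
    else if (a == hi p.1) && (b == hi p.1) then p.2.1.2
    else if (a == lo p.1) && (b == hi p.1) then p.2.2 else 0.

Variant sq_mx_entry i (a b : 'I_m.+1) : Prop :=
  | SqLoLo of a = lo i & b = lo i
  | SqHiHi of a = hi i & b = hi i
  | SqLoHi of a = lo i & b = hi i.

Lemma sq_mx_neq0 p a b : sq_mx p a b != 0 -> sq_mx_entry p.1 a b.
Proof.
rewrite mxE; case: ifP => [/andP[/eqP-> /eqP->] _|_]; first exact: SqLoLo.
case: ifP => [/andP[/eqP-> /eqP->] _|_]; first exact: SqHiHi.
case: ifP => [/andP[/eqP-> /eqP->] _|_]; first exact: SqLoHi.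
by rewrite eqxx.
Qed.

Lemma sq_mx_lo_hi p : sq_mx p (lo p.1) (hi p.1) = p.2.2.
Proof. by rewrite mxE !eqxx lo_eq_hi hi_eq_lo. Qed.

(** The nonzero superdiagonal entry is the only nonzero one off the diagonal, so it reveals the
    place; the three values are then read off. *)
Lemma sq_mx_inj : {in sq_dom m &, injective sq_mx}.
Proof.
move=> p p'; rewrite !inE => nz nz' e.
have pp' : p.1 = p'.1.
  move: nz; rewrite -sq_mx_lo_hi e.
  case/sq_mx_neq0 => [e1 e2 | e1 e2 | /lo_inj //].
    by move: (hi_eq_lo p.1); rewrite e2 -e1 eqxx.
  by move: (lo_eq_hi p.1); rewrite e1 -e2 eqxx.
case: p p' pp' e {nz nz'} => [i [[x y] z]] [i' [[x' y'] z']] /= <- {i'} e.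
have := sq_mx_lo_hi (i, (x, y, z)); rewrite e sq_mx_lo_hi /= => <-.
move/matrixP: e => e.
have := e (lo i) (lo i); rewrite !mxE !eqxx /= => <-.
by have := e (hi i) (hi i); rewrite !mxE !eqxx hi_eq_lo /= => <-.
Qed.

(** Only the blocks at [lo] and [hi] can be nonzero. The first has row [lo] as its only nonzero row;
    any other block misses position [(lo, lo)], which leaves column [hi]. *)
Lemma flag_rank_sq_mx p : (flag_rank (sq_mx p) <= 2)%N.
Proof.
have lo_hi : (lo p.1 < hi p.1)%N by rewrite hiE.
have card2 : #|[set lo p.1; hi p.1]| = 2%N by rewrite cards2 lo_eq_hi.
rewrite -card2; apply: flag_rank_le_card => [k|]; last first.
  apply/subsetP=> k /flag_supportP[a [b [akb /sq_mx_neq0]]].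
  rewrite !inE -!(inj_eq (@ord_inj _)) loE hiE.
  by case=> ea eb; move: akb; rewrite ea eb ?hiE ?loE; lia.
have [-> | ne_k] := eqVneq k (lo p.1).
  apply: (@rank_flag_sub_row _ _ _ _ (lo p.1)) => c d kcd ne_c.
  apply/eqP; apply: contraNT ne_c => /sq_mx_neq0[-> // | ec _ | -> //].
  by rewrite ec in kcd; lia.
apply: (@rank_flag_sub_col _ _ _ _ (hi p.1)) => c d kcd ne_d.
apply/eqP; apply: contraNT ne_d => /sq_mx_neq0[ec ed | _ -> // | _ -> //].
rewrite ec ed in kcd; case/eqP: ne_k; apply/ord_inj/eqP.
by rewrite eqn_leq andbC.
Qed.

Lemma upper_sq_mx p : upper_mx (sq_mx p).
Proof.
apply/upper_mxP => a b lt_ba; apply/eqP; apply: contraLR lt_ba.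
by case/sq_mx_neq0 => -> ->; rewrite ?hiE ?loE; lia.
Qed.

(** The nonzero superdiagonal entry already puts [lo i] and [hi i] in the support, which has at most
    two elements. Any nonzero entry [(c, d)] puts [c] and [d] there as well. *)
Lemma sq_mxP (A : 'M[F]_m.+1) i : upper_mx A -> (flag_rank A <= 2)%N ->
  A (lo i) (hi i) != 0 ->
  A = sq_mx (i, (A (lo i) (lo i), A (hi i) (hi i), A (lo i) (hi i))).
Proof.
move=> /upper_mxP Aup frA nz.
have suppA : flag_support A = [set lo i; hi i].
  apply/eqP; rewrite eq_sym eqEcard cards2 lo_eq_hi.
  rewrite (leq_trans (card_flag_support_le A)) ?andbT //.
  by apply/subsetP=> k /set2P[]->; apply/flag_supportP; exists (lo i), (hi i);
    rewrite nz hiE loE ?leqnn ?leqnSn.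
apply/matrixP=> c d; rewrite mxE /=.
case: ifP => [/andP[/eqP-> /eqP->] //|n1].
case: ifP => [/andP[/eqP-> /eqP->] //|n2].
case: ifP => [/andP[/eqP-> /eqP->] //|n3].
have [/Aup // | le_cd] := ltnP d c.
apply/eqP; apply/negPn/negP => Acd.
have : c \in flag_support A.
  by apply/flag_supportP; exists c, d; rewrite leqnn le_cd.
have : d \in flag_support A.
  by apply/flag_supportP; exists c, d; rewrite leqnn le_cd.
rewrite suppA !inE => /orP[]/eqP dE /orP[]/eqP cE; subst c d;
  rewrite !eqxx in n1 n2 n3 => //.
(* The remaining case [(hi, lo)] is below the diagonal. *)
by move: le_cd; rewrite hiE loE ltnn.
Qed.

End Square.

Lemma upper_diag_of n (d : {ffun 'I_n -> F}) : upper_mx (diag_of d).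
Proof.
apply/upper_mxP => a b; rewrite mxE ltnNge; case: eqVneq => [-> | //].
by rewrite leqnn.
Qed.

Lemma flag_rank_diag_of n (d : {ffun 'I_n -> F}) :
  (flag_rank (diag_of d) <= #|[set i | d i != 0%R]|)%N.
Proof.
apply: flag_rank_le_card => [k|].
  apply: (@rank_flag_sub_row _ _ _ _ k) => a b kab ne_ak; rewrite mxE.
  case: eqVneq => // ab; case/eqP: ne_ak; apply: val_inj; rewrite -ab in kab.
  by apply/eqP; rewrite /= eqn_leq.
apply/subsetP=> k /flag_supportP[a [b [akb]]]; rewrite mxE inE.
case: (eqVneq a b) => [ab | _]; last by rewrite eqxx.
rewrite -ab in akb; suff -> : a = k by [].
by apply: val_inj; apply/eqP; rewrite /= eqn_leq.
Qed.

(** A nonzero entry [(c, d)] off the diagonal would have [d > c + 1], so [c], [c + 1] and [d] would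
    be three elements of the support. *)
Lemma diag_ofP m (A : 'M[F]_m.+1) : upper_mx A -> (flag_rank A <= 2)%N ->
  (forall i, A (lo i) (hi i) = 0) ->
  exists2 d, d \in sparse m.+1 & A = diag_of d.
Proof.
move=> /upper_mxP Aup frA A0.
have supp2 := leq_trans (card_flag_support_le A) frA.
have in_supp (c d k : 'I_m.+1) : (c <= k <= d)%N -> A c d != 0 ->
    k \in flag_support A.
  by move=> ckd Acd; apply/flag_supportP; exists c, d.
exists [ffun i => A i i].
  rewrite inE; apply: leq_trans supp2; apply: subset_leq_card.
  by apply/subsetP=> i; rewrite inE ffunE; apply: in_supp; rewrite leqnn.
apply/matrixP=> c d; rewrite !mxE ffunE; case: eqVneq => [<- // | ne_cd].
have [/Aup // | le_cd] := ltnP d c.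
apply/eqP; apply/negPn/negP => Acd.
have lt_cm : (c < m)%N.
  by move: ne_cd (ltn_ord d); rewrite -val_eqE /=; lia.
have c_lo : c = lo (Ordinal lt_cm) by apply: val_inj.
have [d_hi | ne_d] := eqVneq d (hi (Ordinal lt_cm)).
  by rewrite c_lo d_hi A0 eqxx in Acd.
have lt_hd : (c.+1 < d)%N.
  by move: ne_cd ne_d; rewrite -!(inj_eq (@ord_inj _)) hiE /=; lia.
have: (#|[set c; hi (Ordinal lt_cm); d]| <= 2)%N.
  apply: leq_trans supp2; apply/subset_leq_card/subsetP=> k.
  by case/setUP=> [/set2P[]|/set1P]->; apply: (in_supp c d) => //;
    rewrite ?hiE /=; lia.
rewrite -setUA cardsU1 cards2 !inE -!(inj_eq (@ord_inj _)) hiE /=.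
by rewrite !(@ltn_eqF c, @ltn_eqF c.+1) // ltnW.
Qed.

Lemma card_fr_ball2 m :
  fr_ball F m.+1 2 = (1 + m.+1 * #|F|.-1 + 'C(m.+1, 2) * #|F|.-1 ^ 2
                      + m * (#|F| * #|F| * #|F|.-1))%N.
Proof.
rewrite /fr_ball -card_sparse -card_sq_dom -(card_imset _ (@diag_of_inj m.+1)).
rewrite -(card_in_imset (@sq_mx_inj m)).
(* Subtract the size of the empty intersection, so that [cardsU] folds the sum into the size of a
   union. *)
rewrite -[RHS]subn0 -[X in (_ - X)%N](@cards0 'M[F]_m.+1).
have <- : (@diag_of m.+1 @: sparse m.+1) :&: (@sq_mx m @: sq_dom m) = set0.
  apply/setP=> A; rewrite !inE; apply/negP=> /andP[/imsetP[d _ ->]].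
  case/imsetP=> p; rewrite inE => nz /matrixP/(_ (lo p.1) (hi p.1)).
  by rewrite sq_mx_lo_hi mxE lo_eq_hi => z0; rewrite -z0 eqxx in nz.
rewrite -cardsU; apply: eq_card => A; rewrite !inE; apply/andP/orP.
  case=> Aup frA.
  have [/existsP[i nz] | /existsPn noi] :=
      boolP [exists i, A (lo i) (hi i) != 0].
    by right; rewrite (sq_mxP Aup frA nz) imset_f // inE.
  left; have [i | d sd ->] := diag_ofP Aup frA; last exact: imset_f.
  by apply/eqP; move: (noi i); rewrite negbK.
case=> /imsetP[]; last first.
  by move=> p _ ->; rewrite upper_sq_mx flag_rank_sq_mx.
move=> d; rewrite inE => d2 ->; rewrite upper_diag_of; split=> //.
exact: leq_trans (flag_rank_diag_of d) d2.
Qed.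

End Ball.

(** * The quadratic equation and the theorem *)

Lemma quadratic_rootP (R : rcfType) (q N P : R) :
  1 < q -> 1 <= N -> q <= P ->
  2 * P = 2 + 2 * (N * (q - 1)) + N * (N - 1) * (q - 1) ^+ 2
          + 2 * ((N - 1) * (q * q * (q - 1)))
  <-> N = (- (2 * q ^+ 2 - q + 3)
           + Num.sqrt ((2 * q ^+ 2 + q + 1) ^+ 2 + 8 * (P - q)))
          / (2 * (q - 1)).
Proof.
move=> q_gt1 N_ge1 le_qP; set D := _ ^+ 2 + _; set B := 2 * q ^+ 2 - q + 3.
have D_ge0 : 0 <= D by rewrite addr_ge0 ?sqr_ge0 // mulr_ge0 // subr_ge0.
have q1_neq0 : 2 * (q - 1) != 0.
  by rewrite mulf_neq0 ?pnatr_eq0 // subr_eq0 gt_eqF.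
(* This sign selects the root with the positive square root. *)
have root_ge0 : 0 <= 2 * (q - 1) * N + B by rewrite /B; nra.
(* Completing the square: the second equation is 4 times the first, rearranged. *)
have step : 2 * P = 2 + 2 * (N * (q - 1)) + N * (N - 1) * (q - 1) ^+ 2
          + 2 * ((N - 1) * (q * q * (q - 1)))
          <-> (2 * (q - 1) * N + B) ^+ 2 = D.
  by rewrite /B /D; split=> h; lra.
rewrite step; split=> [<- | ->].
  by rewrite sqrtr_sqr ger0_norm // addrCA addNr addr0 mulrAC divff // mul1r.
by rewrite mulrC divfK // addrAC addNr add0r sqr_sqrtr.
Qed.

Theorem theorem5p9 (R : rcfType) (F : finFieldType) (n : nat)
    (C : {vspace 'M[F]_n}) (n_ge1 : (1 <= n)%N)
    (codeC : linear_fr_code C) (distC : has_min_distance C 5) :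
  let q : R := #|F|%:R in
  let alpha : nat := codimension C in
  (perfect_code C <->
     n%:R = (- (2 * q ^+ 2 - q + 3)
             + Num.sqrt ((2 * q ^+ 2 + q + 1) ^+ 2 + 8 * (q ^+ alpha - q)))
            / (2 * (q - 1))) /\
  (5 < alpha)%N.
Proof.
have le_dim := dim_code_le codeC distC.
move=> q alpha; have alphaE : (\dim C + alpha = (n * n.+1) %/ 2)%N.
  by rewrite /alpha /codimension subnKC //; apply: leq_trans le_dim; lia.
split; last by lia.
have F_gt1 : (1 < #|F|)%N := finNzRing_gt1 F.
(* The minimum distance is unique, so the radius is [(5 - 1) %/ 2 = 2]; then cancel the size of
   [C]. *)
have perfectE : perfect_code C <-> fr_ball F n 2 = (#|F| ^ alpha)%N.
  rewrite -alphaE in le_dim *; split=> [[d distCd] | eq_b].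
    have -> : d = 5%N.
      case: distC distCd => [[M [CM nzM <-]] minC] [[M' [CM' nzM' <-]] minC'].
      by apply/eqP; rewrite eqn_leq minC // minC'.
    rewrite card_code -alphaE expnD => /eqP.
    by rewrite eqn_pmul2l ?expn_gt0 ?(ltnW F_gt1) // => /eqP.
  by exists 5%N => //; rewrite card_code -alphaE expnD eq_b.
have q_gt1 : 1 < q by rewrite /q -[1]/(1%:R) ltr_nat.
have n_pos : 1 <= n%:R :> R by rewrite -[1]/(1%:R) ler_nat.
(* Makes the discriminant nonnegative; it needs [alpha] positive. *)
have q_pow : q <= q ^+ alpha by rewrite -[leLHS]expr1 ler_weXn2l ?ltW //; lia.
rewrite -quadratic_rootP // {}perfectE -[in fr_ball _ _ _](prednK n_ge1).
rewrite card_fr_ball2 prednK //.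
have binE : 2 * 'C(n, 2)%:R = n%:R * (n%:R - 1) :> R.
  have -> : n%:R - 1 = n.-1%:R :> R.
    by rewrite -[in LHS](prednK n_ge1) -natr1 addrK.
  rewrite -!natrM; congr _%:R.
  by rewrite -[2%N]/(2`!)%N mulnC bin_ffact ffactnS ffactn1.
have predE k : (0 < k)%N -> k.-1%:R = k%:R - 1 :> R.
  by move=> k0; rewrite -[in RHS](prednK k0) -natr1 addrK.
have -> : 2 * q ^+ alpha = 2 * (#|F| ^ alpha)%:R by rewrite natrX.
(* Pass from naturals to [R] by injectivity of the cast, doubling to match the quadratic
   equation. *)
transitivity (2 * (1 + n * #|F|.-1 + 'C(n, 2) * #|F|.-1 ^ 2
   + n.-1 * (#|F| * #|F| * #|F|.-1))%:R = 2 * (#|F| ^ alpha)%:R :> R).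
  split=> [-> // | /mulfI]; rewrite pnatr_eq0 => /(_ isT)/eqP.
  by rewrite eqr_nat => /eqP.
rewrite !natrD !natrM natrX !predE ?(ltnW F_gt1) // -/q.
have -> : 'C(n, 2)%:R = n%:R * (n%:R - 1) / 2 :> R by lra.
by split=> h; lra.
Qed.
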